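(* Let $G$ be a finite simplicial graph with probability-space-vertices, and let $(A^G,E^G)$ be the corresponding graph free probability space over $D^G$. Let $s\in\mathbb{N}$ and let $\{x_1,\dots,x_s\}$ and $\{y_1,\dots,y_s\}$ be sets of $G$-random variables in $(A^G,E^G)$. If these two sets are $G$-free, then (1) $R^G_{x_1+y_1,\dots,x_s+y_s}(z_1,\dots,z_s)=\big(R^G_{x_1,\dots,x_s}+R^G_{y_1,\dots,y_s}\big)(z_1,\dots,z_s)$; (2) $R^G_{x_1,\dots,x_s,y_1,\dots,y_s}(z_1,\dots,z_{2s})=R^G_{x_1,\dots,x_s}(z_1,\dots,z_s)+R^G_{y_1,\dots,y_s}(z_{s+1},\dots,z_{2s})$.
   Context: A noncommutative probability space $(A,\varphi)$ is a unital complex algebra $A$ with a linear functional $\varphi:A\to\mathbb{C}$, $\varphi(1)=1$. $G$ is a finite simplicial (undirected, no loops, no multiple edges) graph with vertex set $V(G)$; to each $v\in V(G)$ is attached a noncommutative probability space $(A_v,\varphi_v)$ (a ''probability-space-vertex''). A finite path $[v_1,v_2],[v_2,v_3],\dots,[v_k,v_{k+1}]$ (successive edges of $G$) is denoted $w=[v_1,\dots,v_{k+1}]$, is identified with the reversed path $[v_{k+1},\dots,v_1]$, and has length $|w|=k=|\{v_1,\dots,v_{k+1}\}|-1$. $FP(G)$ is the set of all finite paths of length $\ge 1$, and $\mathbb{F}^+(G)=V(G)\cup FP(G)$. For $w=[v_1,\dots,v_k]\in FP(G)$ put $A_w=A_{v_1}*\cdots*A_{v_k}$ and $\varphi_w=\varphi_{v_1}*\cdots*\varphi_{v_k}$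 (usual free product); for a vertex $w$, $(A_w,\varphi_w)$ is the attached space. The graph free product is $A^G=\mathbb{C}\oplus\big(\bigoplus_{w\in\mathbb{F}^+(G)}A_w\big)$ with componentwise operations (a direct sum consisting of all families $\oplus_w a_w$, with unit the family of units); $D^G=\mathbb{C}\oplus\big(\bigoplus_{w\in\mathbb{F}^+(G)}\mathbb{C}_w\big)$, $\mathbb{C}_w=\mathbb{C}$; the conditional expectation $E^G:A^G\to D^G$ is $\bigoplus_{w}\varphi_w$ (identity on the first summand $\mathbb{C}$). $(A^G,E^G)$ is the graph free probability space, and elements of $A^G$ are called $G$-random variables. $D^G$ commutes with $A^G$. The $D^G$-valued cumulants ($G$-cumulants) are $k_n^{(E^G)}(x_1,\dots,x_n)=\sum_{\pi\in NC(n)}\big(\prod_{V\in\pi}E^G(\prod_{i\in V}x_i)\big)\mu(\pi,1_n)$ (products within a block in increasing order of indices; $NC(n)$ the lattice of noncrossing partitions of $\{1,\dots,n\}$, $\mu$ its Möbius function). Subalgebras $A_1,A_2$ of $A^G$ are $G$-free if all their mixed $D^G$-valued cumulants vanish, i.e. $k_n^{(E^G)}(a_1,\dots,a_n)=0$ whenever $n\ge2$, $a_j\in A_{i_j}$ and $(i_1,\dots,i_n)\in\{1,2\}^n$ is not constant. Subsets $X_1,X_2$ of $A^G$ are $G$-free if the subalgebras generated by $X_1\cup D^G$ and $X_2\cup D^G$ are $G$-free. The graph R-transform of $G$-random variables $x_1,\dots,x_s$ is the formal series $$R^G_{x_1,\dots,x_s}(z_1,\dots,z_s)=\sum_{n=1}^\infty\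 \sum_{(i_1,\dots,i_n)\in\{1,\dots,s\}^n}k_n^{(E^G)}(x_{i_1},\dots,x_{i_n})\,z_{i_1}\cdots z_{i_n}\in D^G[[z_1,\dots,z_s]]$$ in noncommuting indeterminates $z_1,\dots,z_s$. *)

(* Defs.v *)
From HB Require Import structures.
From mathcomp Require Import all_boot all_order all_algebra.
From mathcomp Require Import all_classical all_reals.
From mathcomp Require Import complex.

Set Implicit Arguments.
Unset Strict Implicit.
Unset Printing Implicit Defensive.

Import Order.TTheory GRing.Theory Num.Theory.

Local Open Scope ring_scope.

(* Noncommutative probability spaces over a field C; the theorem is about
   C = R[i] with R the real numbers. *)
Record ncProb (C : fieldType) := NcProb {
  nc_alg :> algType C;
  nc_state : {scalar nc_alg};
  nc_state1 : nc_state 1 = 1 }.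

Section ScalarSpace.
Variable C : fieldType.

Let idC (x : C^o) : C := x.

Fact idC_scalar : scalar idC.
Proof. by []. Qed.

HB.instance Definition _ := GRing.isLinear.Build C C^o C *%R idC idC_scalar.

Definition scalar_prob : ncProb C :=
  @NcProb C C^o (idC : {scalar C^o}) (erefl 1).

End ScalarSpace.

(* The free product (with identification of units) of a family of algebras is
   given by generators and relations: the unital algebra generated by the
   elements of the A i, subject to the relations holding in each A i. *)
Section FreeProduct.
Variables (C : fieldType) (I : eqType) (A : I -> ncProb C).

Inductive fp_term :=
  | Gen (i : I) of A i
  | Scal of C
  | Add of fp_term & fp_term
  | Mul of fp_term & fp_term.

Inductive fp_eq : fp_term -> fp_term -> Prop :=
  | fp_refl x : fp_eq x x
  | fp_sym x y : fp_eq x y -> fp_eq y x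
  | fp_trans x y z : fp_eq x y -> fp_eq y z -> fp_eq x z
  | fp_congD x x' y y' : fp_eq x x' -> fp_eq y y' -> fp_eq (Add x y) (Add x' y')
  | fp_congM x x' y y' : fp_eq x x' -> fp_eq y y' -> fp_eq (Mul x y) (Mul x' y')
  | fp_addA x y z : fp_eq (Add x (Add y z)) (Add (Add x y) z)
  | fp_addC x y : fp_eq (Add x y) (Add y x)
  | fp_add0 x : fp_eq (Add (Scal 0) x) x
  | fp_addN x : fp_eq (Add (Mul (Scal (-1)) x) x) (Scal 0)
  | fp_mulA x y z : fp_eq (Mul x (Mul y z)) (Mul (Mul x y) z)
  | fp_mul1l x : fp_eq (Mul (Scal 1) x) x
  | fp_mul1r x : fp_eq (Mul x (Scal 1)) x
  | fp_mulDl x y z : fp_eq (Mul (Add x y) z) (Add (Mul x z) (Mul y z))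
  | fp_mulDr x y z : fp_eq (Mul x (Add y z)) (Add (Mul x y) (Mul x z))
  | fp_scalC c x : fp_eq (Mul (Scal c) x) (Mul x (Scal c))
  | fp_scalD c d : fp_eq (Scal (c + d)) (Add (Scal c) (Scal d))
  | fp_scalM c d : fp_eq (Scal (c * d)) (Mul (Scal c) (Scal d))
  | fp_genD i (a b : A i) : fp_eq (Gen (a + b)) (Add (Gen a) (Gen b))
  | fp_genM i (a b : A i) : fp_eq (Gen (a * b)) (Mul (Gen a) (Gen b))
  | fp_genS i c : fp_eq (Gen (c%:A : A i)) (Scal c).

HB.instance Definition _ := gen_eqMixin fp_term.
HB.instance Definition _ := gen_choiceMixin fp_term.

Definition fp_eqb (x y : fp_term) : bool := `[< fp_eq x y >].

Fact fp_eqb_refl : reflexive fp_eqb.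
Proof. by move=> x; apply/asboolP; apply: fp_refl. Qed.
Fact fp_eqb_sym : symmetric fp_eqb.
Proof. by move=> x y; apply/asboolP/asboolP; apply: fp_sym. Qed.
Fact fp_eqb_trans : transitive fp_eqb.
Proof. by move=> y x z /asboolP xy /asboolP yz; apply/asboolP/(fp_trans xy). Qed.

Canonical fp_equiv := EquivRel fp_eqb fp_eqb_refl fp_eqb_sym fp_eqb_trans.

Definition free_prod := {eq_quot fp_equiv}%qT.

HB.instance Definition _ := Choice.on free_prod.

Definition fp_pi (t : fp_term) : free_prod := \pi_free_prod%qT t.
Definition fp_repr (x : free_prod) : fp_term := repr x.

Lemma fp_piE t t' : fp_eq t t' <-> fp_pi t = fp_pi t'.
Proof.
split=> [tt'|/eqquotP/asboolP//]; apply/eqquotP; exact/asboolP.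
Qed.

Lemma fp_reprK x : fp_pi (fp_repr x) = x. Proof. exact: reprK. Qed.

Lemma fp_repr_pi t : fp_eq (fp_repr (fp_pi t)) t.
Proof. by apply/fp_piE; rewrite fp_reprK. Qed.

Definition fp_add x y := fp_pi (Add (fp_repr x) (fp_repr y)).
Definition fp_mul x y := fp_pi (Mul (fp_repr x) (fp_repr y)).
Definition fp_opp x := fp_pi (Mul (Scal (-1)) (fp_repr x)).
Definition fp_scale c x := fp_pi (Mul (Scal c) (fp_repr x)).

Lemma fp_pi_add s t : fp_add (fp_pi s) (fp_pi t) = fp_pi (Add s t).
Proof. by apply/fp_piE/fp_congD; exact: fp_repr_pi. Qed.
Lemma fp_pi_mul s t : fp_mul (fp_pi s) (fp_pi t) = fp_pi (Mul s t).
Proof. by apply/fp_piE/fp_congM; exact: fp_repr_pi. Qed.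
Lemma fp_pi_opp t : fp_opp (fp_pi t) = fp_pi (Mul (Scal (-1)) t).
Proof. by apply/fp_piE/fp_congM; [exact: fp_refl|exact: fp_repr_pi]. Qed.
Lemma fp_pi_scale c t : fp_scale c (fp_pi t) = fp_pi (Mul (Scal c) t).
Proof. by apply/fp_piE/fp_congM; [exact: fp_refl|exact: fp_repr_pi]. Qed.

Lemma free_prodP x : exists t, x = fp_pi t.
Proof. by exists (fp_repr x); rewrite fp_reprK. Qed.

Ltac fp_lift := repeat (let x := fresh "x" in move=> x; have [? ->] := free_prodP x);
  rewrite ?(fp_pi_add, fp_pi_mul, fp_pi_opp, fp_pi_scale); apply/fp_piE.

Fact free_addrA : associative fp_add.
Proof. by fp_lift; exact: fp_addA. Qed.
Fact free_addrC : commutative fp_add.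
Proof. by fp_lift; exact: fp_addC. Qed.
Fact free_add0r : left_id (fp_pi (Scal 0)) fp_add.
Proof. by fp_lift; exact: fp_add0. Qed.
Fact free_addNr : left_inverse (fp_pi (Scal 0)) fp_opp fp_add.
Proof. by fp_lift; exact: fp_addN. Qed.
Fact free_mulrA : associative fp_mul.
Proof. by fp_lift; exact: fp_mulA. Qed.
Fact free_mul1r : left_id (fp_pi (Scal 1)) fp_mul.
Proof. by fp_lift; exact: fp_mul1l. Qed.
Fact free_mulr1 : right_id (fp_pi (Scal 1)) fp_mul.
Proof. by fp_lift; exact: fp_mul1r. Qed.
Fact free_mulrDl : left_distributive fp_mul fp_add.
Proof. by fp_lift; exact: fp_mulDl. Qed.
Fact free_mulrDr : right_distributive fp_mul fp_add.
Proof. by fp_lift; exact: fp_mulDr. Qed.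

(* Words, and the action of the terms on functions of words, are used only to
   show that the free product is nontrivial and that the free product of the
   states exists.  The action of t on f is to be read as w |-> f (t w), where
   f is a function of the reduced words: words of centered elements, in which
   successive letters come from different algebras. *)
Let letter := {i : I & A i}.
Let word := seq letter.
Let st (i : I) (a : A i) : C := nc_state (A i) a.
Let ctr (i : I) (a : A i) : A i := a - (st a)%:A.
Local Notation Let_ a := (existT (fun i => A i : Type) _ a).

Let stD i (a b : A i) : st (a + b) = st a + st b.
Proof. by rewrite /st raddfD. Qed.
Let stZ i c (a : A i) : st (c *: a) = c * st a.
Proof. by rewrite /st linearZ. Qed.
Let st1 i : st (1 : A i) = 1.
Proof. exact: nc_state1. Qed.
Let st_ctr i (a : A i) : st (ctr a) = 0.
Proof. by rewrite /ctr -scaleN1r stD !stZ st1 mulr1 mulN1r subrr. Qed.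
Let ctrP i c (a b : A i) : ctr (c *: a + b) = c *: ctr a + ctr b.
Proof.
by rewrite /ctr stD stZ scalerBr scalerDl scalerA opprD addrACA.
Qed.

Definition gen_act (i : I) (a : A i) (f : word -> C) (w : word) : C :=
  let put (b : A i) w' := st b * f w' + f (Let_ (ctr b) :: w') in
  if w is v :: w' then
    if tag v == i then put (a * tagged_as (Let_ a) v) w' else put a w
  else put a w.

Arguments gen_act : simpl never.

Fixpoint act (t : fp_term) (f : word -> C) (w : word) : C :=
  match t with
  | Gen i a => gen_act a f w
  | Scal c => c * f w
  | Add s t => act s f w + act t f w
  | Mul s t => act t (act s f) w
  end.

Let reduced (w : word) :=
  sorted (fun u v => tag u != tag v) w /\ {in w, forall u, st (tagged u) = 0}.

Let multilinear (f : word -> C) := forall w1 i c (a b : A i) w2,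
  f (w1 ++ Let_ (c *: a + b) :: w2) =
  c * f (w1 ++ Let_ a :: w2) + f (w1 ++ Let_ b :: w2).

Let gen_act_nil i (a : A i) f :
  gen_act a f [::] = st a * f [::] + f [:: Let_ (ctr a)].
Proof. by []. Qed.

Let gen_act_same i (a b : A i) f w : gen_act a f (Let_ b :: w) =
  st (a * b) * f w + f (Let_ (ctr (a * b)) :: w).
Proof. by rewrite /gen_act /= eqxx tagged_asE. Qed.

Let gen_act_diff i (a : A i) f v w : tag v != i ->
  gen_act a f (v :: w) = st a * f (v :: w) + f (Let_ (ctr a) :: v :: w).
Proof. by move=> /negPf vi; rewrite /gen_act vi. Qed.

Let gen_act_multi i (a : A i) f : multilinear f -> multilinear (gen_act a f).
Proof.
move=> mf [|[j b] w1] k c x y w2 /=.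
  have [eki|nki] := eqVneq k i.
    subst k; rewrite !gen_act_same mulrDr -scalerAr ctrP.
    by rewrite (mf [::]) stD stZ !mulrDl mulrDr mulrA addrACA.
  rewrite !gen_act_diff // (mf [::]) (mf [:: _]) /= !mulrDr.
  by rewrite addrACA [st a * (c * _)]mulrCA.
have [eji|nji] := eqVneq j i.
  subst j; rewrite !gen_act_same mf (mf (_ :: _)) /= !mulrDr.
  by rewrite addrACA [st _ * (c * _)]mulrCA.
rewrite !gen_act_diff // (mf (_ :: _)) (mf [:: _, _ & _]) /= !mulrDr.
by rewrite addrACA [st a * (c * _)]mulrCA.
Qed.

Let act_multi t f : multilinear f -> multilinear (act t f).
Proof.
elim: t f => [i a|c|s IHs t IHt|s IHs t IHt] f mf /=; first exact: gen_act_multi.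
- by move=> w1 i d a b w2; rewrite mf mulrDr mulrCA.
- by move=> w1 i d a b w2; rewrite IHs // IHt // mulrDr addrACA.
- by apply: IHt; apply: IHs.
Qed.

Let reduced_behead v w : reduced (v :: w) -> reduced w.
Proof.
move=> [/path_sorted sw cw]; split=> // u uw; apply: cw.
by rewrite inE uw orbT.
Qed.

Let reduced_cons i (a : A i) w : reduced w -> (if w is v :: _ then tag v != i else true) ->
  reduced (Let_ (ctr a) :: w).
Proof.
case: w => [|v w] [sw cw] vi; split=> //=.
- by move=> u; rewrite inE => /eqP ->; rewrite st_ctr.
- by rewrite eq_sym vi.
- by move=> u; rewrite inE => /orP[/eqP ->|/cw//]; rewrite st_ctr.
Qed.

Let reduced_tag i (a : A i) w : reduced (Let_ a :: w) ->
  if w is v :: _ then tag v != i else true.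
Proof. by case: w => // v w [/= /andP[+ _] _]; rewrite eq_sym. Qed.

Let gen_actE i (a : A i) f w : (if w is v :: _ then tag v != i else true) ->
  gen_act a f w = st a * f w + f (Let_ (ctr a) :: w).
Proof. by case: w => [|v w] // /gen_act_diff ->. Qed.

Let act_ext t f g w : (forall w, reduced w -> f w = g w) -> reduced w ->
  act t f w = act t g w.
Proof.
elim: t f g w => [i a|c|s IHs t IHt|s IHs t IHt] f g w fg rw /=.
- case: w rw => [|[j b] w] rw.
    by rewrite !gen_actE // !fg //; apply: reduced_cons.
  have [eji|nji] := eqVneq j i.
    have rw' := reduced_behead rw; subst j; rewrite !gen_act_same !fg //.
    by apply: reduced_cons; last exact: reduced_tag rw.
  by rewrite !gen_actE // !fg //; apply: reduced_cons.
- by rewrite fg.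
- by rewrite (IHs f g) // (IHt f g).
- by apply: IHt => // w' rw'; apply: IHs.
Qed.

Let act_lin t c f g w :
  act t (fun w => c * f w + g w) w = c * act t f w + act t g w.
Proof.
elim: t f g w => [i a|d|s IHs t IHt|s IHs t IHt] f g w /=.
- case: w => [|v w]; rewrite /gen_act; last case: ifP => _;
    by rewrite !mulrDr addrACA [st _ * (c * _)]mulrCA.
- by rewrite mulrDr mulrCA.
- by rewrite IHs IHt mulrDr addrACA.
- rewrite -IHt; congr (act t _ w); apply/funext => w'; exact: IHs.
Qed.

Let act_scale t c f w : act t (act (Scal c) f) w = c * act t f w.
Proof.
rewrite -[act (Scal c) f]/(fun w => c * f w).
elim: t f w => [i a|d|s IHs t IHt|s IHs t IHt] f w /=.
- by case: w => [|v w]; rewrite /gen_act; last case: ifP => _;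
    rewrite mulrDr [st _ * (c * _)]mulrCA.
- by rewrite mulrCA.
- by rewrite IHs IHt mulrDr.
- rewrite -IHt; congr (act t _ w); apply/funext => w'; exact: IHs.
Qed.

Let multi0 f w1 i w2 : multilinear f -> f (w1 ++ Let_ (0 : A i) :: w2) = 0.
Proof.
move=> /(_ w1 i 1 0 0 w2); rewrite scaler0 addr0 mul1r => /eqP.
by rewrite -subr_eq subrr eq_sym => /eqP.
Qed.

Let put_split i (a b : A i) f w : multilinear f ->
  st (a * b) * f w + f (Let_ (ctr (a * b)) :: w) =
  st b * (st a * f w + f (Let_ (ctr a) :: w)) +
  (st (a * ctr b) * f w + f (Let_ (ctr (a * ctr b)) :: w)).
Proof.
move=> mf; have -> : a * b = st b *: a + a * ctr b.
  by rewrite /ctr mulrBr -scalerAr mulr1 addrC subrK.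
move: (a * ctr b) => d; rewrite ctrP (mf [::]) stD stZ mulrDl mulrDr mulrA.
by rewrite addrACA.
Qed.

Let act_eq t t' : fp_eq t t' ->
  forall f w, multilinear f -> reduced w -> act t f w = act t' f w.
Proof.
elim=> {t t'} //=.
- by move=> x y _ IH f w mf rw; rewrite IH.
- by move=> x y z _ IH _ IH' f w mf rw; rewrite IH // IH'.
- by move=> x x' y y' _ IH _ IH' f w mf rw; rewrite IH // IH'.
- move=> x x' y y' _ IH _ IH' f w mf rw; rewrite IH' //; last exact: act_multi.
  by apply: act_ext => // w' rw'; apply: IH.
- by move=> x y z f w _ _; rewrite addrA.
- by move=> x y f w _ _; rewrite addrC.
- by move=> x f w _ _; rewrite mul0r add0r.
- by move=> x f w _ _; rewrite mul0r act_scale mulN1r addNr.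
- by move=> x f w _ _; rewrite act_scale mul1r.
- by move=> x f w _ _; rewrite mul1r.
- move=> x y z f w _ _; rewrite -[act z (act x f) w]mul1r -act_lin.
  by congr (act z _ w); apply/funext => w'; rewrite mul1r.
- by move=> c x f w _ _; rewrite act_scale.
- by move=> c d f w _ _; rewrite mulrDl.
- by move=> c d f w _ _; rewrite mulrCA mulrA.
- move=> i a b f w mf rw.
  have put1 (x y : A i) w' : st (x + y) * f w' + f (Let_ (ctr (x + y)) :: w') =
      (st x * f w' + f (Let_ (ctr x) :: w')) +
      (st y * f w' + f (Let_ (ctr y) :: w')).
    have := ctrP 1 x y; rewrite !scale1r => ->.
    have := mf [::] i 1 (ctr x) (ctr y) w'; rewrite scale1r mul1r /= => ->.
    by rewrite stD mulrDl addrACA.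
  case: w rw => [|[j d] w] rw; first by rewrite !gen_actE.
  have [eji|nji] := eqVneq j i; last by rewrite !gen_actE.
  by subst j; rewrite !gen_act_same mulrDl put1.
- move=> i a b f w mf rw.
  case: w rw => [|[j d] w] rw.
    by rewrite gen_actE // put_split // (gen_actE b) // gen_actE // gen_act_same.
  have [eji|nji] := eqVneq j i; last first.
    by rewrite gen_actE // put_split // (gen_actE b) // (gen_actE a) // gen_act_same.
  subst j; rewrite !gen_act_same -mulrA put_split // gen_actE //.
  exact: reduced_tag rw.
- move=> i c f w mf rw.
  case: w rw => [|[j d] w] rw.
    rewrite gen_actE // stZ st1 mulr1 /ctr stZ st1 mulr1 subrr.
    by rewrite (@multi0 f [::]) // addr0.
  have [eji|nji] := eqVneq j i; last first.
    rewrite gen_actE // stZ st1 mulr1 /ctr stZ st1 mulr1 subrr.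
    by rewrite (@multi0 f [::]) // addr0.
  subst j; rewrite gen_act_same -scalerAl mul1r /ctr stZ.
  have -> : st d = 0 by case: rw => _ /(_ (Let_ d)); apply; rewrite inE eqxx.
  rewrite mulr0 mul0r add0r scale0r subr0.
  have := mf [::] i c d 0 w; rewrite addr0 /= => ->.
  by rewrite (@multi0 f [::]) // addr0.
Qed.

Let delta (w : word) : C := if w is [::] then 1 else 0.

Let delta_multi : multilinear delta.
Proof. by move=> [|? ?] * /=; rewrite mulr0 addr0. Qed.

Let reduced_nil : reduced [::]. Proof. by split. Qed.

Fact free_oner_neq0 : fp_pi (Scal 1) != fp_pi (Scal 0).
Proof.
apply/eqP => /fp_piE /act_eq /(_ delta [::] delta_multi reduced_nil) /=.
by rewrite mul1r mul0r => /eqP; rewrite oner_eq0.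
Qed.

HB.instance Definition _ :=
  GRing.isZmodule.Build free_prod free_addrA free_addrC free_add0r free_addNr.
HB.instance Definition _ := GRing.Zmodule_isNzRing.Build free_prod
  free_mulrA free_mul1r free_mulr1 free_mulrDl free_mulrDr free_oner_neq0.

Fact free_scalerA a b x : fp_scale a (fp_scale b x) = fp_scale (a * b) x.
Proof.
move: x; fp_lift; apply: fp_trans (fp_mulA _ _ _) _.
by apply: fp_congM; [apply: fp_sym; exact: fp_scalM|exact: fp_refl].
Qed.
Fact free_scale1r : left_id 1 fp_scale.
Proof. by fp_lift; exact: fp_mul1l. Qed.
Fact free_scalerDr : right_distributive fp_scale +%R.
Proof.
move=> c x y; have [s ->] := free_prodP x; have [t ->] := free_prodP y.
rewrite -[fp_pi s + _]/(fp_add _ _) -[RHS]/(fp_add _ _).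
by rewrite ?(fp_pi_add, fp_pi_scale); apply/fp_piE/fp_mulDr.
Qed.
Fact free_scalerDl x : {morph fp_scale^~ x : a b / a + b}.
Proof.
move=> c d; have [s ->] := free_prodP x; rewrite -[RHS]/(fp_add _ _).
rewrite ?(fp_pi_add, fp_pi_scale); apply/fp_piE.
apply: fp_trans (fp_mulDl _ _ _).
by apply: fp_congM; [exact: fp_scalD|exact: fp_refl].
Qed.

HB.instance Definition _ := GRing.Zmodule_isLmodule.Build C free_prod
  free_scalerA free_scale1r free_scalerDr free_scalerDl.

Fact free_scalerAl (c : C) (x y : free_prod) : c *: (x * y) = (c *: x) * y.
Proof.
rewrite -[LHS]/(fp_scale _ (fp_mul _ _)) -[RHS]/(fp_mul (fp_scale _ _) _).
by move: x y; fp_lift; exact: fp_mulA.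
Qed.
HB.instance Definition _ := GRing.Lmodule_isLalgebra.Build C free_prod free_scalerAl.

Fact free_scalerAr (c : C) (x y : free_prod) : c *: (x * y) = x * (c *: y).
Proof.
rewrite -[LHS]/(fp_scale _ (fp_mul _ _)) -[RHS]/(fp_mul _ (fp_scale _ _)).
move: x y; fp_lift; apply: fp_trans (fp_scalC _ _) _.
apply: fp_trans (fp_sym (fp_mulA _ _ _)) _; apply: fp_congM; first exact: fp_refl.
exact/fp_sym/fp_scalC.
Qed.
HB.instance Definition _ := GRing.Lalgebra_isAlgebra.Build C free_prod free_scalerAr.

Definition fp_in (i : I) (a : A i) : free_prod := fp_pi (Gen a).

Fact fp_in_linear i : linear (@fp_in i).
Proof.
move=> c a b; rewrite -[RHS]/(fp_add (fp_scale _ _) _) /fp_in.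
rewrite fp_pi_scale fp_pi_add; apply/fp_piE.
apply: fp_trans (fp_genD _ _) _; apply: fp_congD; last exact: fp_refl.
rewrite -[c *: a]mul1r -scalerAr scalerAl; apply: fp_trans (fp_genM _ _) _.
by apply: fp_congM; [exact: fp_genS|exact: fp_refl].
Qed.
HB.instance Definition _ i :=
  GRing.isLinear.Build C (A i) free_prod *:%R (@fp_in i) (@fp_in_linear i).

Fact fp_in_monoid_morphism i : monoid_morphism (@fp_in i).
Proof.
split; last by move=> a b; rewrite -[RHS]/(fp_mul _ _) fp_pi_mul; exact/fp_piE/fp_genM.
by rewrite /fp_in -[1 in LHS](scale1r 1); exact/fp_piE/fp_genS.
Qed.
HB.instance Definition _ i :=
  GRing.isMonoidMorphism.Build (A i) free_prod (@fp_in i) (@fp_in_monoid_morphism i).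

(* The defining properties of the free product of the states. *)
Definition is_free_state (phi : {scalar free_prod}) : Prop :=
  [/\ phi 1 = 1,
   forall i (a : A i), phi (fp_in a) = nc_state (A i) a &
   forall u : seq {i : I & A i}, u != [::] ->
     sorted (fun x y => tag x != tag y) u ->
     {in u, forall x, nc_state (A (tag x)) (tagged x) = 0} ->
     phi (\prod_(x <- u) fp_in (tagged x)) = 0].

Lemma free_state_exists : exists phi, is_free_state phi.
Proof.
pose phi (x : free_prod) := act (fp_repr x) delta [::].
have phiE t : phi (fp_pi t) = act t delta [::].
  by apply: act_eq => //; exact: fp_repr_pi.
have phi_lin : scalar phi.
  move=> c x y; have [s ->] := free_prodP x; have [t ->] := free_prodP y.
  rewrite -[_ + _]/(fp_add (fp_scale _ _) _) fp_pi_scale fp_pi_add !phiE /=.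
  by rewrite act_scale.
pose phiL := GRing.isLinear.Build C free_prod C *%R phi phi_lin.
pose phi' : {scalar free_prod} := HB.pack phi phiL.
exists phi'; split=> [|i a|u un su cu].
- by rewrite -[LHS]/(phi _) phiE /= mulr1.
- by rewrite -[LHS]/(phi _) phiE /= gen_act_nil mulr1 addr0.
pose prodt := foldr (fun x : letter => Mul (Gen (tagged x))) (Scal 1).
have -> : \prod_(x <- u) fp_in (tagged x) = fp_pi (prodt u).
  elim: u {un su cu} => [|x u IH]; first by rewrite big_nil.
  by rewrite big_cons IH -[LHS]/(fp_mul _ _) fp_pi_mul.
rewrite -[LHS]/(phi _) phiE.
have act_prod f v : reduced v -> act (prodt v) f [::] = f v.
  elim: v f => [|[i a] v IH] f rv; first by rewrite /= mul1r.
  rewrite [LHS]/= (IH (gen_act a f)) ?gen_actE; last exact: reduced_behead rv.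
    have a0 : st a = 0 by case: rv => _ /(_ (Let_ a)); apply; rewrite inE eqxx.
    by rewrite a0 mul0r add0r /ctr a0 scale0r subr0.
  exact: reduced_tag rv.
by rewrite act_prod //; case: u un {su cu}.
Qed.

Inductive spanned : free_prod -> Prop :=
  | spanned_prod u : reduced u -> spanned (\prod_(x <- u) fp_in (tagged x))
  | spanned_lin c x y : spanned x -> spanned y -> spanned (c *: x + y).

Let spanned1 : spanned 1.
Proof. by have := spanned_prod reduced_nil; rewrite big_nil. Qed.

Let spanned0 : spanned 0.
Proof.
have s1 := spanned1.
by have := spanned_lin (-1) s1 s1; rewrite scaleN1r addNr.
Qed.

Let spannedD x y : spanned x -> spanned y -> spanned (x + y).
Proof. by move=> sx sy; rewrite -[x]scale1r; exact: spanned_lin. Qed.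

Let spannedZ c x : spanned x -> spanned (c *: x).
Proof. by move=> sx; rewrite -[_ *: _]addr0; exact: spanned_lin. Qed.

Let spanned_put i (a : A i) w : reduced w ->
  (if w is v :: _ then tag v != i else true) ->
  spanned (fp_in a * \prod_(x <- w) fp_in (tagged x)).
Proof.
move=> rw wi; have -> : a = st a *: 1 + ctr a by rewrite /ctr addrC subrK.
rewrite linearP rmorph1 mulrDl -scalerAl mul1r; apply: spanned_lin.
  exact: spanned_prod.
by have := spanned_prod (reduced_cons a rw wi); rewrite big_cons.
Qed.

Let spanned_gen i (a : A i) x : spanned x -> spanned (fp_in a * x).
Proof.
elim=> {x} [w rw|c x y _ sx _ sy]; last first.
  by rewrite mulrDr -scalerAr; exact: spanned_lin.
case: w rw => [|[j b] w] rw; first exact: spanned_put.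
have [eji|nji] := eqVneq j i; last exact: spanned_put.
subst j; rewrite big_cons mulrA /= -rmorphM; apply: spanned_put.
  exact: reduced_behead rw.
exact: reduced_tag rw.
Qed.

Let spanned_mul t x : spanned x -> spanned (fp_pi t * x).
Proof.
elim: t x => [i a|c|s IHs t IHt|s IHs t IHt] x sx; first exact: spanned_gen.
- have -> : fp_pi (Scal c) = c%:A.
    rewrite -[RHS]/(fp_scale c (fp_pi (Scal 1))) fp_pi_scale.
    by apply/fp_piE/fp_sym/fp_mul1r.
  by rewrite -scalerAl mul1r; exact: spannedZ.
- have -> : fp_pi (Add s t) = fp_pi s + fp_pi t by rewrite -fp_pi_add.
  rewrite mulrDl.
  by apply: spannedD; [exact: IHs|exact: IHt].
- have -> : fp_pi (Mul s t) = fp_pi s * fp_pi t by rewrite -fp_pi_mul.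
  rewrite -mulrA.
  by apply: IHs; exact: IHt.
Qed.

Lemma free_state_unique phi psi :
  is_free_state phi -> is_free_state psi -> phi =1 psi.
Proof.
move=> [phi1 _ phi0] [psi1 _ psi0] x.
have : spanned x.
  rewrite -[x]mulr1 -[x]fp_reprK; exact: spanned_mul.
elim=> {x} [u ru|c x y _ IHx _ IHy]; last by rewrite !linearP /= IHx IHy.
have [->|un] := eqVneq u [::]; first by rewrite big_nil phi1 psi1.
by case: ru => su cu; rewrite phi0 // psi0.
Qed.

Definition free_state : {scalar free_prod} := sval (cid free_state_exists).

Lemma free_stateP : is_free_state free_state.
Proof. exact: svalP (cid free_state_exists). Qed.

Fact free_state1 : free_state 1 = 1.
Proof. by case: free_stateP. Qed.

Definition free_prob : ncProb C := @NcProb C free_prod free_state free_state1.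

End FreeProduct.

(* The direct sum of the C-algebras A o, consisting of all families.  The
   index type is an option type, so that it is inhabited. *)
Section DirectSum.
Variables (C : fieldType) (J : Type) (A : option J -> ncProb C).

Definition dsum := forall o, A o.

HB.instance Definition _ := gen_eqMixin dsum.
HB.instance Definition _ := gen_choiceMixin dsum.

Let ext (x y : dsum) : (forall o, x o = y o) -> x = y.
Proof. exact: functional_extensionality_dep. Qed.

Definition dsum_zero : dsum := fun o => 0.
Definition dsum_one : dsum := fun o => 1.
Definition dsum_opp (x : dsum) : dsum := fun o => - x o.
Definition dsum_add (x y : dsum) : dsum := fun o => x o + y o.
Definition dsum_mul (x y : dsum) : dsum := fun o => x o * y o.
Definition dsum_scale (c : C) (x : dsum) : dsum := fun o => c *: x o.

Fact dsum_addA : associative dsum_add.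
Proof. by move=> x y z; apply: ext => o; exact: addrA. Qed.
Fact dsum_addC : commutative dsum_add.
Proof. by move=> x y; apply: ext => o; exact: addrC. Qed.
Fact dsum_add0 : left_id dsum_zero dsum_add.
Proof. by move=> x; apply: ext => o; exact: add0r. Qed.
Fact dsum_addN : left_inverse dsum_zero dsum_opp dsum_add.
Proof. by move=> x; apply: ext => o; exact: addNr. Qed.
Fact dsum_mulA : associative dsum_mul.
Proof. by move=> x y z; apply: ext => o; exact: mulrA. Qed.
Fact dsum_mul1l : left_id dsum_one dsum_mul.
Proof. by move=> x; apply: ext => o; exact: mul1r. Qed.
Fact dsum_mul1r : right_id dsum_one dsum_mul.
Proof. by move=> x; apply: ext => o; exact: mulr1. Qed.
Fact dsum_mulDl : left_distributive dsum_mul dsum_add.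
Proof. by move=> x y z; apply: ext => o; exact: mulrDl. Qed.
Fact dsum_mulDr : right_distributive dsum_mul dsum_add.
Proof. by move=> x y z; apply: ext => o; exact: mulrDr. Qed.
Fact dsum_one_neq0 : dsum_one != dsum_zero.
Proof.
apply/eqP => /(congr1 (fun x : dsum => x None)) /eqP.
by rewrite [_ == _]oner_eq0.
Qed.

HB.instance Definition _ :=
  GRing.isZmodule.Build dsum dsum_addA dsum_addC dsum_add0 dsum_addN.
HB.instance Definition _ := GRing.Zmodule_isNzRing.Build dsum
  dsum_mulA dsum_mul1l dsum_mul1r dsum_mulDl dsum_mulDr dsum_one_neq0.

Fact dsum_scalerA a b x : dsum_scale a (dsum_scale b x) = dsum_scale (a * b) x.
Proof. by apply: ext => o; exact: scalerA. Qed.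
Fact dsum_scale1r : left_id 1 dsum_scale.
Proof. by move=> x; apply: ext => o; exact: scale1r. Qed.
Fact dsum_scalerDr : right_distributive dsum_scale +%R.
Proof. by move=> c x y; apply: ext => o; exact: scalerDr. Qed.
Fact dsum_scalerDl x : {morph dsum_scale^~ x : a b / a + b}.
Proof. by move=> a b; apply: ext => o; exact: scalerDl. Qed.

HB.instance Definition _ := GRing.Zmodule_isLmodule.Build C dsum
  dsum_scalerA dsum_scale1r dsum_scalerDr dsum_scalerDl.

Fact dsum_scalerAl (c : C) (x y : dsum) : c *: (x * y) = (c *: x) * y.
Proof. by apply: ext => o; exact: scalerAl. Qed.
HB.instance Definition _ := GRing.Lmodule_isLalgebra.Build C dsum dsum_scalerAl.

Fact dsum_scalerAr (c : C) (x y : dsum) : c *: (x * y) = x * (c *: y).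
Proof. by apply: ext => o; exact: scalerAr. Qed.
HB.instance Definition _ := GRing.Lalgebra_isAlgebra.Build C dsum dsum_scalerAr.

End DirectSum.

Section Moebius.
Context {d : Order.disp_t} {T : finPOrderType d}.
Local Open Scope order_scope.

Fixpoint moebius_rec (n : nat) (x y : T) : int :=
  if n is n'.+1 then
    if x == y then 1%R
    else if x < y then (- \sum_(z | (x <= z < y)%O) moebius_rec n' x z)%R else 0%R
  else 0%R.

(* The length of a chain is at most #|T|, which is thus enough fuel. *)
Definition moebius (x y : T) : int := moebius_rec #|T| x y.

Let interval (x y : T) : {set T} := finset (fun z => x <= z <= y).

Let moebius_recE n x y : (#|interval x y| <= n)%N -> x <= y ->
  forall m, (#|interval x y| <= m)%N -> moebius_rec n x y = moebius_rec m x y.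
Proof.
elim: n x y => [|n IH] x y cn xy m cm.
  have : y \in interval x y by rewrite inE xy lexx.
  by move: cn; rewrite leqn0 cards_eq0 => /eqP ->; rewrite inE.
case: m cm => [|m] cm.
  have : y \in interval x y by rewrite inE xy lexx.
  by move: cm; rewrite leqn0 cards_eq0 => /eqP ->; rewrite inE.
rewrite /=; case: ifP => // _; case: ifP => // _; congr (- _)%R.
apply: eq_bigr => z /andP[xz zy].
have lt_card : (#|interval x z| < #|interval x y|)%N.
  apply: proper_card; apply/properP; split.
    by apply/fintype.subsetP => u; rewrite !inE => /andP[-> uz] /=; rewrite (le_trans uz) ?ltW.
  by exists y; rewrite !inE ?xy ?lexx //= lt_geF // andbF.
by apply: IH => //; rewrite -ltnS; apply: leq_trans lt_card _.
Qed.

Lemma moebiusE x y : moebius x y =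
  if x == y then 1%R
  else if x < y then (- \sum_(z | (x <= z < y)%O) moebius x z)%R else 0%R.
Proof.
have cT z z' : (#|interval z z'| <= #|T|)%N by exact: max_card.
case: (boolP (x <= y)) => xy.
  by rewrite /moebius (@moebius_recE _ x y _ xy #|T|.+1) //; exact: leqW.
rewrite /moebius; case: #|T| (cT x x) => [|n _] /=.
  by rewrite leqn0 cards_eq0 => /eqP/setP/(_ x); rewrite !inE lexx.
by case: eqP xy => [->|_ /negPf xy]; rewrite ?lexx // lt_def xy andbF.
Qed.

Lemma sum_moebius x y : x <= y ->
  (\sum_(z | (x <= z <= y)%O) moebius x z = (x == y)%:R :> int)%R.
Proof.
move=> xy; rewrite (bigD1 y) /=; last by rewrite xy lexx.
have -> : (\sum_(z | (x <= z <= y)%O && (z != y)) moebius x z =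
           \sum_(z | (x <= z < y)%O) moebius x z)%R.
  by apply: eq_bigl => z; rewrite -andbA lt_neqAle [(_ != _) && _]andbC.
rewrite moebiusE lt_neqAle xy andbT; case: eqVneq => [->|nxy] /=.
  by rewrite big1 ?addr0 // => z /andP[yz zy]; move: (le_lt_trans yz zy); rewrite ltxx.
by rewrite addNr.
Qed.

End Moebius.

Section NoncrossingPartitions.
Local Open Scope nat_scope.
Variable n : nat.

Definition noncrossing (P : {set {set 'I_n}}) : bool :=
  [forall V in P, forall W in P, forall a in V, forall b in W,
   forall c in V, forall d in W, [&& a < b, b < c & c < d] ==> (V == W)].

Definition is_nc (P : {set {set 'I_n}}) : bool :=
  finset.partition P [set: 'I_n] && noncrossing P.

Definition NC : Type := {P : {set {set 'I_n}} | is_nc P}.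

HB.instance Definition _ := Finite.on NC.
HB.instance Definition _ := SubType.on NC.

(* Reversed refinement: every block of p is contained in a block of q. *)
Definition nc_le (p q : NC) : bool :=
  [forall V in val p, exists W in val q, V \subset W].

Fact nc_le_refl : reflexive nc_le.
Proof. by move=> p; apply/forall_inP => V pV; apply/exists_inP; exists V. Qed.

Fact nc_le_trans : transitive nc_le.
Proof.
move=> q p r /forall_inP pq /forall_inP qr; apply/forall_inP => V /pq.
by case/exists_inP => W /qr /exists_inP[U rU WU] VW;
  apply/exists_inP; exists U => //; exact: fintype.subset_trans WU.
Qed.

Fact nc_le_anti : antisymmetric nc_le.
Proof.
suff sub p q : nc_le p q -> nc_le q p -> val p \subset val q.
  by move=> p q /andP[pq qp]; apply/val_inj/eqP; rewrite finset.eqEsubset !sub.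
move=> /forall_inP pq /forall_inP qp; apply/fintype.subsetP => V pV.
have /andP[/and3P[_ tp p0] _] := valP p.
have /exists_inP[W qW VW] := pq _ pV; have /exists_inP[U pU WU] := qp _ qW.
have VU : V = U.
  apply/eqP/negPn/negP => nVU.
  have := finset.trivIsetP tp _ _ pV pU nVU; rewrite -finset.setI_eq0 (finset.setIidPl _).
    by move=> /eqP V0; move: p0; rewrite -V0 pV.
  exact: fintype.subset_trans WU.
by have -> // : V = W; apply/eqP; rewrite finset.eqEsubset VW VU.
Qed.

Fact nc_display : Order.disp_t. Proof. exact: Order.Disp tt tt. Qed.

HB.instance Definition _ :=
  Order.Le_isPOrder.Build nc_display NC nc_le_refl nc_le_anti nc_le_trans.

(* The partition with one block, or with no block if n = 0. *)
Definition one_block : {set {set 'I_n}} := [set [set: 'I_n]] :\ finset.set0.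

Fact one_block_nc : is_nc one_block.
Proof.
apply/andP; split.
  apply/and3P; split; last by rewrite !inE eqxx.
    rewrite /cover; apply/eqP/setP => i; rewrite inE; apply/finset.bigcupP.
    exists [set: 'I_n]; rewrite !inE // eqxx andbT.
    by apply/finset.set0Pn; exists i; rewrite inE.
  by apply/finset.trivIsetP => V W; rewrite !inE => /andP[_ /eqP ->] /andP[_ /eqP ->]; rewrite eqxx.
apply/forall_inP => V; rewrite !inE => /andP[_ /eqP ->].
apply/forall_inP => W; rewrite !inE => /andP[_ /eqP ->].
do 4!(apply/forall_inP => ? _); exact/implyP.
Qed.

Definition nc_one : NC := exist _ one_block one_block_nc.

End NoncrossingPartitions.

(* The inner product is taken in increasing order of the indices, which is the
   order of the enumeration of 'I_n. *)
Definition cumulant (A : pzRingType) (D : comPzRingType) (E : A -> D)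
    (n : nat) (x : 'I_n -> A) : D :=
  \sum_(p : NC n)
    (\prod_(V in val p) E (\prod_(i in V) x i)) *~ moebius p (nc_one n).

(* Formal power series in s noncommuting indeterminates, as the functions
   mapping a word i_1 ... i_n to the coefficient of z_(i_1) ... z_(i_n). *)
Definition ncseries (D : zmodType) (s : nat) : Type := seq 'I_s -> D.

HB.instance Definition _ (D : zmodType) (s : nat) :=
  GRing.Zmodule.copy (ncseries D s) (seq 'I_s -> D).

(* The series F(z_(f 1), ..., z_(f s)) *)
Definition rename_vars (D : zmodType) (s t : nat) (f : 'I_s -> 'I_t)
    (F : ncseries D s) : ncseries D t :=
  fun w => \sum_(u : (size w).-tuple 'I_s | map f u == w) F u.

Definition Rtransform (A : pzRingType) (D : comPzRingType) (E : A -> D)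
    (s : nat) (x : 'I_s -> A) : ncseries D s :=
  fun w => if w is [::] then 0
           else cumulant E (fun k : 'I_(size w) => x (tnth (in_tuple w) k)).

Local Open Scope classical_set_scope.

Definition vanishing_mixed_cumulants (A : pzRingType) (D : comPzRingType)
    (E : A -> D) (B : bool -> set A) : Prop :=
  forall (n : nat) (c : 'I_n -> bool) (a : 'I_n -> A),
    (2 <= n)%N -> (exists j k, c j != c k) -> (forall j, B (c j) (a j)) ->
    cumulant E a = 0.

Definition subalgebra (C : fieldType) (A : algType C) (S : set A) : Prop :=
  [/\ S 1, forall c u v, S u -> S v -> S (c *: u + v)
   & forall u v, S u -> S v -> S (u * v)].

Record simple_graph := SimpleGraph {
  vertex : finType;
  edge : rel vertex;
  edge_sym : symmetric edge;
  edge_irrefl : irreflexive edge }.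

Section Paths.
Variable G : simple_graph.

(* The sequence of vertices of a path of length at least 1.  The vertices are
   pairwise distinct since the length of a path [v_1, ..., v_(k+1)] is
   k = |{v_1, ..., v_(k+1)}| - 1. *)
Definition is_path (w : seq (vertex G)) : bool :=
  [&& (1 < size w)%N, sorted (@edge G) w & uniq w].

Definition vertex_path : Type := {w : seq (vertex G) | is_path w}.

HB.instance Definition _ := Choice.on vertex_path.
HB.instance Definition _ := SubType.on vertex_path.

Definition same_path (w w' : vertex_path) : bool :=
  (val w == val w') || (val w == rev (val w')).

Fact same_path_refl : reflexive same_path.
Proof. by move=> w; rewrite /same_path eqxx. Qed.
Fact same_path_sym : symmetric same_path.
Proof.
move=> w w'; rewrite /same_path eq_sym; congr (_ || _).
by rewrite -(inj_eq (can_inj revK)) revK eq_sym.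
Qed.
Fact same_path_trans : transitive same_path.
Proof.
move=> w2 w1 w3; rewrite /same_path => /orP[]/eqP -> /orP[]/eqP ->;
  by rewrite ?revK eqxx ?orbT.
Qed.

Canonical same_path_equiv :=
  EquivRel same_path same_path_refl same_path_sym same_path_trans.

Definition FP : Type := {eq_quot same_path_equiv}%qT.

Definition FPplus : Type := (vertex G + FP)%type.

(* Only membership in this sequence matters below, and it does not depend on
   the representative of w. *)
Definition path_vertices (w : FP) : seq (vertex G) :=
  val (@repr _ {eq_quot same_path_equiv}%qT w).

End Paths.

Section GraphFreeProduct.
Variables (C : fieldType) (G : simple_graph) (A : vertex G -> ncProb C).

(* The index None stands for the leading summand C. *)
Definition summand (o : option (FPplus G)) : ncProb C :=
  match o with
  | None => scalar_prob C
  | Some (inl v) => A v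
  | Some (inr w) =>
      free_prob (fun u : {v : vertex G | v \in path_vertices w} => A (val u))
  end.

Definition AG : algType C := dsum summand.

Definition DG : comPzRingType := option (FPplus G) -> C.

Definition EG (x : AG) : DG := fun o => nc_state (summand o) (x o).

Definition DG_in_AG (d : DG) : AG := fun o => (d o)%:A.

Definition Gfree_subalgebras (B1 B2 : set AG) : Prop :=
  vanishing_mixed_cumulants EG (fun b => if b then B2 else B1).

Definition Gfree (X1 X2 : set AG) : Prop :=
  Gfree_subalgebras (smallest (@subalgebra C AG) (X1 `|` range DG_in_AG))
                    (smallest (@subalgebra C AG) (X2 `|` range DG_in_AG)).

Definition RG (s : nat) (x : 'I_s -> AG) : ncseries DG s := Rtransform EG x.

End GraphFreeProduct.

(* x_1, ..., x_s, y_1, ..., y_t *)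
Definition append (T : Type) (s t : nat) (x : 'I_s -> T) (y : 'I_t -> T)
    (i : 'I_(s + t)) : T :=
  match fintype.split i with inl j => x j | inr k => y k end.

(* Main.v *)
(* A D-valued cumulant is a sum over noncrossing partitions of products in which
   each argument occurs exactly once, hence additive in each argument.  Expanding
   k_n(x_{i_1} + y_{i_1}, ..., x_{i_n} + y_{i_n}), only the two terms with no
   mixture of x's and y's survive G-freeness; this gives (1).  The coefficients of
   the joint R-transform are the cumulants of words in the x's and y's, of which
   again only the unmixed ones survive; this gives (2). *)
Require Import Defs.
From mathcomp Require Import all_boot all_order all_algebra.
From mathcomp Require Import all_classical all_reals.
From mathcomp Require Import complex.

Set Implicit Arguments.
Unset Strict Implicit.
Unset Printing Implicit Defensive.

Import Order.TTheory GRing.Theory Num.Theory.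

Local Open Scope classical_set_scope.
Local Open Scope ring_scope.

(** Additivity in the argument at [j]. The three families are tied by pointwise hypotheses, so they
    may be given by any formulas and no function update is involved. *)
Definition multiadditive (I : eqType) (A D : zmodType) (F : (I -> A) -> D) : Prop :=
  forall (j : I) (a b c : I -> A), a j = b j + c j ->
    (forall i, i != j -> a i = b i /\ a i = c i) -> F a = F b + F c.

(** Subsets are sorted by whether they contain [j]; those that do correspond to subsets of [S] by
    removing [j]. *)
Lemma sum_subset_setU1 (T : finType) (D : zmodType) (G : {set T} -> D)
    (j : T) (S : {set T}) : j \notin S ->
  \sum_(U : {set T} | U \subset j |: S) G U =
  \sum_(U : {set T} | U \subset S) G U + \sum_(U : {set T} | U \subset S) G (j |: U).
Proof.
move=> jS; rewrite (bigID (fun U : {set T} => j \in U)) /= addrC; congr (_ + _).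
  apply: eq_bigl => U; apply/andP/idP => [[/fintype.subsetP US jU]|US].
    apply/fintype.subsetP => i iU; have := US _ iU; rewrite in_setU1.
    by case/orP => // /eqP eij; rewrite -eij iU in jU.
  split; first exact: fintype.subset_trans US (finset.subsetUr _ _).
  by apply: contra jS; exact: (fintype.subsetP US).
rewrite (reindex_onto (fun U : {set T} => j |: U) (fun U : {set T} => U :\ j)) /=;
  last by move=> U /andP[_ jU]; exact: finset.setD1K.
apply: eq_bigl => U; rewrite setU11 andbT.
apply/andP/idP => [[US /eqP eU]|US].
  apply/fintype.subsetP => i iU; have ij : i != j.
    by move: iU; rewrite -eU in_setD1 => /andP[].
  have := fintype.subsetP US i; rewrite !in_setU1 (negPf ij) /=; exact.
split; first exact: finset.setUS.
by rewrite finset.setU1K //; apply: contra jS; exact: (fintype.subsetP US).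
Qed.

Lemma multiadditive_expand (T : finType) (A D : zmodType) (F : (T -> A) -> D)
    (x y : T -> A) : multiadditive F ->
  F (fun i => x i + y i) =
  \sum_(U : {set T}) F (fun i => if i \in U then y i else x i).
Proof.
move=> FD.
(* [S] is the set of positions that still carry a sum. The family [x] is generalised as well,
   because choosing [y j] at a position [j] changes it. *)
suff expand (S : {set T}) : forall x, F (fun i => if i \in S then x i + y i else x i) =
    \sum_(U : {set T} | U \subset S) F (fun i => if i \in U then y i else x i).
  have := expand (finset.setTfor T) x; under eq_fun do rewrite finset.in_setT.
  by move=> ->; apply: eq_bigl => U; rewrite finset.subsetT.
have [n] := ubnP #|S|; elim: n S => // n IH S; rewrite ltnS => cS {}x.
have [->|[j jS]] := finset.set_0Vmem S.
  under eq_bigl do rewrite finset.subset0.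
  by rewrite big_pred1_eq; congr F; apply/funext => i; rewrite !finset.in_set0.
have jS' : j \notin S :\ j by rewrite finset.setD11.
rewrite -[in RHS](finset.setD1K jS) sum_subset_setU1 //.
have {}IH x' : _ = _ := IH (S :\ j) (leq_trans (proper_card (finset.properD1 jS)) cS) x'.
(* [x'] records the choice of [y] at [j]; with it the terms indexed by [j |: U] become an expansion
   over the smaller set [S :\ j]. *)
rewrite -IH; set x' := fun i => if i == j then y j else x i.
have -> : \sum_(U : {set T} | U \subset S :\ j)
    F (fun i => if i \in j |: U then y i else x i) =
    \sum_(U : {set T} | U \subset S :\ j) F (fun i => if i \in U then y i else x' i).
  apply: eq_bigr => U _; congr F; apply/funext => i; rewrite in_setU1 /x'.
  by case: eqVneq => [->|_] //=; case: ifP.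
rewrite -IH; apply: (FD j) => [|i ij].
  by rewrite jS (negPf jS') /x' eqxx.
by rewrite /x' in_setD1 ij (negPf ij).
Qed.

Lemma multiadditive_split (T : finType) (A D : zmodType) (F : (T -> A) -> D)
    (x y : T -> A) : multiadditive F -> (0 < #|T|)%N ->
  (forall U : {set T}, (exists j k, (j \in U) != (k \in U)) ->
     F (fun i => if i \in U then y i else x i) = 0) ->
  F (fun i => x i + y i) = F x + F y.
Proof.
move=> FD T0 mixed; rewrite (multiadditive_expand x y FD).
(* Since [T] is inhabited, the empty and the full set are two different indices, giving the terms
   [F x] and [F y]. *)
have neT : finset.setTfor T != finset.set0 by rewrite -card_gt0 finset.cardsT.
rewrite (bigD1 (finset.set0 : {set T})) //= (bigD1 (finset.setTfor T)) //=.
rewrite big1 ?addr0 => [|U /andP[/finset.set0Pn[j jU] UT]].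
  by congr (F _ + F _); apply/funext => i; rewrite ?finset.in_set0 ?finset.in_setT.
apply: mixed; exists j; have: ~~ (finset.setTfor T \subset U) by rewrite finset.subTset.
by case/subsetPn => k _ kU; exists k; rewrite jU (negPf kU).
Qed.

(** As [r] has no repetition, the factor at [j] occurs exactly once; the factors before and after it
    agree for the three families, and distributivity concludes. *)
Lemma multiadditive_prod (I : eqType) (A : pzRingType) (r : seq I) (P : pred I)
    (j : I) (a b c : I -> A) : uniq r -> j \in r -> P j ->
  a j = b j + c j -> (forall i, i != j -> a i = b i /\ a i = c i) ->
  \prod_(i <- r | P i) a i = \prod_(i <- r | P i) b i + \prod_(i <- r | P i) c i.
Proof.
move=> + jr Pj aj ai; case/splitPr: jr => r1 r2.
rewrite uniq_catC /= mem_cat negb_or => /andP[/andP[j2 j1] _].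
have same (s : seq I) : j \notin s ->
    \prod_(i <- s | P i) b i = \prod_(i <- s | P i) a i /\
    \prod_(i <- s | P i) c i = \prod_(i <- s | P i) a i.
  move=> js; split; rewrite big_seq_cond [RHS]big_seq_cond; apply: eq_bigr => i /andP[si _];
    by have /ai[ab ac] : i != j by [apply: contraNneq js => <-]; rewrite -?ab -?ac.
rewrite !big_cat !big_cons /= Pj aj.
by have [-> ->] := same _ j1; have [-> ->] := same _ j2; rewrite mulrDl mulrDr.
Qed.

(** In the term of a partition, [j] lies in exactly one block. Additivity of [E] splits the factor
    of that block, and the other blocks do not see the change at [j]. *)
Lemma multiadditive_cumulant (A : pzRingType) (D : comPzRingType) (E : A -> D)
    (n : nat) : {morph E : u v / u + v} -> multiadditive (@cumulant A D E n).
Proof.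
move=> ED j a b c aj ai; rewrite /cumulant -big_split; apply: eq_bigr => p _ /=.
have /andP[/and3P[/eqP cp tp _] _] := valP p.
have jp : j \in finset.cover (val p) by rewrite cp finset.in_setT.
have pV := finset.pblock_mem jp; have jV : j \in finset.pblock (val p) j by rewrite finset.mem_pblock.
rewrite -mulrzDl; congr (_ *~ _).
rewrite !(bigD1 (finset.pblock (val p) j) pV) /=.
rewrite (multiadditive_prod (index_enum_uniq _) (mem_index_enum j) jV aj ai) ED mulrDl.
have same V : V \in val p -> V != finset.pblock (val p) j ->
    \prod_(i in V) b i = \prod_(i in V) a i /\ \prod_(i in V) c i = \prod_(i in V) a i.
  move=> Vp Vj; split; apply: eq_bigr => i iV;
    have /ai[ab ac] : i != j by apply: contraNneq Vj => <-; rewrite (finset.def_pblock tp Vp iV).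
    by rewrite ab.
  by rewrite ac.
by congr (_ * _ + _ * _); apply: eq_bigr => V /andP[Vp Vj]; have [bV cV] := same _ Vp Vj; rewrite ?bV ?cV.
Qed.

(** Serves to compare cumulants indexed by [size (map f u)] and by [size u], which are equal but not
    convertible. *)
Lemma cumulant_cast (A : pzRingType) (D : comPzRingType) (E : A -> D) (m n : nat)
    (e : m = n) (a : 'I_n -> A) : cumulant E (fun k => a (cast_ord e k)) = cumulant E a.
Proof. by subst m; congr cumulant; apply/funext => k; rewrite cast_ord_id. Qed.

Lemma Rtransform_map (A : pzRingType) (D : comPzRingType) (E : A -> D) (s t : nat)
    (f : 'I_s -> 'I_t) (x : 'I_t -> A) (u : seq 'I_s) :
  Rtransform E x (map f u) = Rtransform E (fun i => x (f i)) u.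
Proof.
case: u => [//|i u]; rewrite /Rtransform -[LHS](cumulant_cast E (esym (size_map f (i :: u)))).
congr cumulant; apply/funext => k.
rewrite (tnth_nth (f i)) (tnth_nth i) (nth_map i) /=; [by [] | exact: ltn_ord k].
Qed.

Section RenameVars.
Variables (D : zmodType) (s t : nat) (f : 'I_s -> 'I_t) (F : ncseries D s).

(** Injectivity leaves a single term in the defining sum, that of [u] itself. *)
Lemma rename_vars_map (u : seq 'I_s) : injective f -> rename_vars f F (map f u) = F u.
Proof.
move=> f_inj; have su : size u == size (map f u) by rewrite size_map.
by rewrite /rename_vars (big_pred1 (Tuple su)) // => v; rewrite (inj_eq (inj_map f_inj)).
Qed.

Lemma rename_vars_notin (w : seq 'I_t) (j : 'I_t) :
  j \in w -> j \notin codom f -> rename_vars f F w = 0.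
Proof.
move=> jw jf; apply: big1 => u /eqP uw; case/negP: jf.
by move: jw; rewrite -uw => /mapP[i _ ->]; exact: codom_f.
Qed.

Lemma in_codom_map (w : seq 'I_t) : {subset w <= codom f} -> exists u, w = map f u.
Proof.
elim: w => [|j w IH] wf; first by exists [::].
have /codomP[i ->] := wf j (mem_head _ _).
by have [|u ->] := IH; [move=> k kw; apply: wf; rewrite inE kw orbT | exists (i :: u)].
Qed.

End RenameVars.

Section Vanishing.
Variables (A : pzRingType) (D : comPzRingType) (E : A -> D) (B : bool -> set A).
Hypothesis mixed : vanishing_mixed_cumulants E B.

Lemma cumulant_mixed (n : nat) (c : 'I_n -> bool) (a : 'I_n -> A) (j k : 'I_n) :
  c j != c k -> (forall i, B (c i) (a i)) -> cumulant E a = 0.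
Proof.
move=> cjk Ba; apply: (mixed _ _ Ba); last by exists j, k.
(* Two differently coloured indices force [n] to be at least 2. *)
by case: n c {a Ba} j k cjk => [|[|n]] c j k; [case: j | rewrite !ord1 eqxx |].
Qed.

Lemma Rtransform_add (s : nat) (x y : 'I_s -> A) : {morph E : u v / u + v} ->
  (forall i, B false (x i)) -> (forall i, B true (y i)) ->
  Rtransform E (fun i => x i + y i) = Rtransform E x + Rtransform E y.
Proof.
move=> ED Bx By; apply/funext => -[|i w]; first by rewrite [RHS]addr0.
set v := fun k => tnth (in_tuple (i :: w)) k.
apply: (@multiadditive_split _ _ _ _ (x \o v) (y \o v) (multiadditive_cumulant ED)).
  by rewrite card_ord.
move=> U [j [k jk]].
(* The positions in [U] carry a [y], hence the colour [true]. *)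
by apply: (cumulant_mixed (c := fun i => i \in U) jk) => l /=; case: ifP.
Qed.

Lemma append_lshift (T : Type) (s t : nat) (x : 'I_s -> T) (y : 'I_t -> T) :
  (fun i => append x y (lshift t i)) = x.
Proof. by apply/funext => i; rewrite /append (unsplitK (inl i)). Qed.

Lemma append_rshift (T : Type) (s t : nat) (x : 'I_s -> T) (y : 'I_t -> T) :
  (fun i => append x y (rshift s i)) = y.
Proof. by apply/funext => i; rewrite /append (unsplitK (inr i)). Qed.

Lemma Rtransform_append (s t : nat) (x : 'I_s -> A) (y : 'I_t -> A) :
  (forall i, B false (x i)) -> (forall i, B true (y i)) ->
  Rtransform E (append x y) =
    rename_vars (lshift t) (Rtransform E x) + rename_vars (@rshift s t) (Rtransform E y).
Proof.
move=> Bx By; apply/funext => w; rewrite [RHS]/GRing.add /=.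
have lr (i : 'I_s) : lshift t i \notin codom (@rshift s t).
  by apply/codomP => -[k /eqP]; rewrite eq_lrshift.
have rl (i : 'I_t) : rshift s i \notin codom (lshift t).
  by apply/codomP => -[k /eqP]; rewrite eq_rlshift.
have [/allP/in_codom_map[u ->]|] := boolP (all [in codom (lshift t)] w).
  rewrite Rtransform_map append_lshift rename_vars_map; last exact: lshift_inj.
  (* The empty word lies in the image of both renamings, but its coefficient is 0 in every
     R-transform. A nonempty word has a first letter outside the image of [rshift]. *)
  case: u => [|i u] /=.
    by rewrite (rename_vars_map _ [::] (@rshift_inj s t)) addr0.
  by rewrite (rename_vars_notin _ (mem_head _ _)) ?addr0.
case/allPn => j jw jl; rewrite (rename_vars_notin _ jw jl) add0r.
have [/allP/in_codom_map[u ->]|] := boolP (all [in codom (@rshift s t)] w).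
  by rewrite Rtransform_map append_rshift rename_vars_map //; exact: rshift_inj.
case/allPn => k kw kr; rewrite (rename_vars_notin _ kw kr).
case: w jw kw => // i w /seq_tnthP[j' ej] /seq_tnthP[k' ek] /=.
(* The colour of a position is [true] when its letter stands for some [y]; [j'] is such a position,
   while [k'] carries an [x]. *)
apply: (cumulant_mixed (j := j') (k := k')
   (c := fun l => tnth (in_tuple (i :: w)) l \notin codom (lshift t))).
  rewrite -ej -ek jl; have -> //: k \in codom (lshift t).
  by move: kr; case: (fintype.split_ordP k) => l -> //; rewrite codom_f.
move=> l; rewrite /append; case: (fintype.split_ordP (tnth _ l)) => m ->.
  by rewrite codom_f.
by rewrite rl.
Qed.

End Vanishing.

Theorem theorem2p3 (R : realType) (G : simple_graph)
    (A : vertex G -> ncProb R[i]) (s : nat) (x y : 'I_s -> AG A) :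
  Gfree (range x) (range y) ->
  RG (fun i => x i + y i) = RG x + RG y /\
  RG (append x y) =
    rename_vars (lshift s) (RG x) + rename_vars (@rshift s s) (RG y).
Proof.
move=> free.
(* [EG] applies a linear state in each summand. *)
have ED : {morph @EG _ _ A : u v / u + v}.
  by move=> u v; apply/funext => o; exact: raddfD.
have mem (X : set (AG A)) z : X z -> smallest (@subalgebra _ (AG A)) (X `|` range (@DG_in_AG _ _ A)) z.
  by move=> Xz; apply: sub_gen_smallest; left.
split; [apply: (Rtransform_add free ED) | apply: (Rtransform_append free)];
  by move=> i; apply: mem; exists i.
Qed.
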